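(* For each $n$, let $\tau$ be chosen uniformly at random from $\{-1,1\}^{E(K_n)}$, and let $L = L(K_n^\tau) = D - A$ be the signed Laplacian of the signed complete graph $K_n^\tau$, with eigenvalues $\lambda_1 \ge \cdots \ge \lambda_n$. Then, with probability tending to $1$ as $n \to \infty$, there exists $k \in \{1,\ldots,n\}$ such that $$\sum_{j=1}^k \lambda_j > \binom{n}{2} + \binom{k+1}{2}.$$
   Context: A signed graph $G^\tau$ is a simple graph $G$ together with $\tau : E(G) \to \{-1,1\}$. Its signed adjacency matrix $A$ has $A_{v,w} = \tau(\{v,w\})$ if $vw \in E(G)$ and $0$ otherwise; $D$ is the diagonal matrix of (ordinary) vertex degrees of $G$; the signed Laplacian is $L(G^\tau) = D - A$. Here $G = K_n$, so $|E(G)| = \binom{n}{2}$ and $D = (n-1)I_n$. *)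

(* Defs.v *)
From HB Require Import structures.
From mathcomp Require Import all_boot all_order all_algebra.
From mathcomp Require Import all_classical all_reals all_analysis.

Set Implicit Arguments.
Unset Strict Implicit.
Unset Printing Implicit Defensive.

Import Order.TTheory GRing.Theory Num.Theory.
Import numFieldNormedType.Exports.

Local Open Scope ring_scope.

Record simple_graph (n : nat) := SimpleGraph {
  adj : rel 'I_n;
  adj_sym : symmetric adj;
  adj_irr : irreflexive adj
}.

Definition edge_set (n : nat) (G : simple_graph n) : {set {set 'I_n}} :=
  [set [set p.1; p.2] | p in [set p : 'I_n * 'I_n | adj G p.1 p.2]]%SET.

Definition edge (n : nat) (G : simple_graph n) : finType :=
  {f : {set 'I_n} | f \in edge_set G}.

(* The two signs are encoded by booleans, b standing for (-1) ^+ b: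
   false is the sign 1 and true is the sign -1. *)
Definition signing (n : nat) (G : simple_graph n) : finType :=
  {ffun edge G -> bool}.

(* insub {v, w} is Some f when {v, w} is the edge f of G, None otherwise. *)
Definition signed_adjacency (R : nzRingType) (n : nat) (G : simple_graph n)
    (tau : signing G) : 'M[R]_n :=
  \matrix_(v, w)
    (if insub [set v; w]%SET is Some f then (-1) ^+ tau f else 0).

Definition degree (n : nat) (G : simple_graph n) (v : 'I_n) : nat :=
  #|[set w | adj G v w]%SET|.

Definition degree_matrix (R : nzRingType) (n : nat) (G : simple_graph n) :
    'M[R]_n :=
  diag_mx (\row_v (degree G v)%:R).

Definition signed_laplacian (R : nzRingType) (n : nat) (G : simple_graph n)
    (tau : signing G) : 'M[R]_n :=
  degree_matrix R G - signed_adjacency R tau.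

Lemma complete_sym (n : nat) : symmetric (fun v w : 'I_n => v != w).
Proof. by move=> v w; rewrite eq_sym. Qed.

Lemma complete_irr (n : nat) : irreflexive (fun v w : 'I_n => v != w).
Proof. by move=> v; rewrite eqxx. Qed.

Definition complete_graph (n : nat) : simple_graph n :=
  SimpleGraph (@complete_sym n) (@complete_irr n).

(* s lists the eigenvalues of A, repeated according to multiplicity, in
   nonincreasing order; s is unique when it exists, and it exists for every
   real symmetric A. The eigenvalue of rank j (counted from 1) is s`_(j.-1). *)
Definition ordered_eigenvalues (R : realType) (n : nat) (A : 'M[R]_n)
    (s : n.-tuple R) : Prop :=
  sorted >=%R s /\ char_poly A = \prod_(x <- s) ('X - x%:P).

Definition equiprob (R : realType) (T : finType) (P : T -> Prop) : R :=
  #|[set x | `[< P x >]]%SET|%:R / #|T|%:R.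

(* Main.v *)
Require Import Defs.
From HB Require Import structures.
From mathcomp Require Import all_boot all_order all_algebra.
From mathcomp Require Import spectral complex zify ring lra.
Import Order.TTheory GRing.Theory Num.Theory.

Set Implicit Arguments.
Unset Strict Implicit.
Unset Printing Implicit Defensive.

(** Write [L = (n - 1) I - A] and [s = sqrt (n - 2)].  Since [tr L = n (n - 1)],
    for [k = n - m] the claim says that the [m] largest eigenvalues of [A] have
    sum larger than [n + m (m - 3) / 2].  With [m] close to [s] it is enough
    that at least [m] eigenvalues of [A] exceed [(31 / 20) s]; in fact, with high
    probability, a positive proportion of them does.

    Let [N_k] be the matrix of signed non-backtracking walks of length [k].  Then
    [A N_1 = N_2 + (n - 1) I] and [A N_k = N_(k+1) + (n - 2) N_(k-1)] for [k >= 2],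
    so that [N_k / s ^ k] is essentially the Chebyshev polynomial [U_k] at [A / s].
    The second moment of [tr N_k] counts the pairs of closed non-backtracking walks
    that together use every edge an even number of times.  Such a pair has at most
    [k] edges, hence at most [k + 1] vertices, because a closed non-backtracking
    walk contains a cycle.  So [tr N_k / (n s ^ k)] tends to [0] in probability for
    [k >= 1], that is, the moments of the spectrum of [A / s] tend to those of the
    semicircle law.

    The polynomial [(20 x - 31) (10 - x) (x ^ 3 + 2 x ^ 2 - 1) ^ 2] is bounded
    above, is nonpositive for [x <= 31 / 20], and has mean [56 > 0] under the
    semicircle law: a positive proportion of the spectrum lies above [31 / 20]. *)

(** * Closed non-backtracking walks *)

(* The vertex [p] precedes [u] and is forbidden as the next one; taking [p = u]
   leaves the first step free. *)
Fixpoint nb_walk (T : eqType) (p u : T) (t : seq T) : bool :=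
  if t is w :: t' then [&& w != p, w != u & nb_walk u w t'] else true.

Definition walk_edges (T : finType) (u : T) (t : seq T) : seq {set T} :=
  pairmap (fun v w => [set v; w]) u t.

(** A step to a new vertex uses a new edge, because the edges of [E] stay inside [V]. *)
Lemma walk_discovery (T : finType) (V : {set T}) (E : {set {set T}})
    (u : T) (t : seq T) :
  (forall e, e \in E -> e \subset V) -> u \in V ->
  #|V :|: [set:: t]| + #|E| <= #|V| + #|E :|: [set:: walk_edges u t]|.
Proof.
elim: t V E u => [|w t IH] V E u EV uV /=.
  by rewrite !set_nil !setU0.
rewrite !set_cons !setUA.
have EV' e : e \in E :|: [set [set u; w]] -> e \subset V :|: [set w].
  rewrite !inE => /orP[/EV /subset_trans -> //|/eqP ->]; first exact: subsetUl.
  by rewrite subUset !sub1set !inE uV eqxx orbT.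
have := IH _ _ w EV'; rewrite !inE eqxx orbT => /(_ isT).
have [wV|wV] := boolP (w \in V).
  have -> : V :|: [set w] = V by apply/setUidPl; rewrite sub1set.
  apply: leq_trans; rewrite leq_add2l subset_leq_card //; exact: subsetUl.
have eE : [set u; w] \notin E.
  by apply: contra wV => /EV /subsetP; apply; rewrite !inE eqxx orbT.
rewrite (setUC V) (setUC E) !cardsU1 wV eE.
by rewrite addnCA -addnA leq_add2l.
Qed.

(* The step after the last discovered vertex uses an edge that discovers
   nothing, whence the gain of one over [walk_discovery]. *)
Lemma nb_walk_discovery (T : finType) (V : {set T}) (E : {set {set T}})
    (z p u : T) (t : seq T) :
  (forall e, e \in E -> e \subset V) -> u \in V -> z \in V -> z != u ->
  (forall e, e \in E -> u \in e -> e = [set p; u]) ->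
  nb_walk p u t -> last u t = z ->
  (#|V :|: [set:: t]| + #|E|).+1 <= #|V| + #|E :|: [set:: walk_edges u t]|.
Proof.
elim: t V E p u => [|w t IH] V E p u EV uV zV zu Eu /=.
  by move=> _ uz; rewrite uz eqxx in zu.
case/and3P=> wp wu nbt lastz.
rewrite !set_cons !setUA.
have EV' e : e \in E :|: [set [set u; w]] -> e \subset V :|: [set w].
  rewrite !inE => /orP[/EV /subset_trans -> //|/eqP ->]; first exact: subsetUl.
  by rewrite subUset !sub1set !inE uV eqxx orbT.
have [wV|wV] := boolP (w \in V).
  have := walk_discovery t EV'; move/(_ w); rewrite !inE eqxx orbT => /(_ isT).
  have -> : V :|: [set w] = V by apply/setUidPl; rewrite sub1set.
  (* The only possible edge of [E] at [u] is [{p, u}], and [w] differs from both ends. *)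
  have eE : [set u; w] \notin E.
    apply/negP => /Eu; rewrite !inE eqxx => /(_ isT) /setP /(_ w).
    by rewrite !inE eqxx orbT (negPf wp) (negPf wu).
  by rewrite (setUC E) !cardsU1 eE addnCA.
have eE : [set u; w] \notin E.
  by apply: contra wV => /EV /subsetP; apply; rewrite !inE eqxx orbT.
have := IH _ _ u w EV'; rewrite !inE zV eqxx orbT => /(_ isT isT).
have zw : z != w by apply: contraNneq wV => <-.
have Ew e : e \in E :|: [set [set u; w]] -> w \in e -> e = [set u; w].
  rewrite !inE => /orP[/EV /subsetP eV /eV|/eqP-> //].
  by rewrite (negPf wV).
move=> /(_ zw Ew nbt lastz).
rewrite (setUC V) (setUC E) !cardsU1 wV eE.
by rewrite addnCA -addnS -addnA leq_add2l.
Qed.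

(** After the first step there are two vertices and one edge; as the walk must still leave [w] for
    [u], the gain in [nb_walk_discovery] cancels this surplus. *)
Lemma closed_nb_walk_card (T : finType) (u : T) (t : seq T) :
  0 < size t -> nb_walk u u t -> last u t = u ->
  #|[set:: u :: t]| <= #|[set:: walk_edges u t]|.
Proof.
case: t => [//|w t] _ /= /and3P[wu _ nbt] lastu.
have EV e : e \in [set [set u; w]] -> e \subset [set u; w].
  by rewrite inE => /eqP ->.
have := @nb_walk_discovery T [set u; w] [set [set u; w]] u u w t EV.
rewrite !inE !eqxx orbT eq_sym => /(_ isT isT wu).
have Ew e : e \in [set [set u; w]] -> w \in e -> e = [set u; w].
  by rewrite inE => /eqP.
move=> /(_ Ew nbt lastu); rewrite !set_cons setUA cards1 cards2 eq_sym wu.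
by rewrite addn1 !ltnS.
Qed.

Lemma set_seq_cat (T : finType) (s t : seq T) :
  [set:: s ++ t] = [set:: s] :|: [set:: t].
Proof. by apply/setP => x; rewrite !inE mem_cat. Qed.

(** Only the start [v] may be a vertex that no edge pays for: the closed first walk has no surplus,
    and later discoveries each bring an edge. *)
Lemma nb_walk_pair_card (T : finType) (u v : T) (s t : seq T) :
  0 < size s -> nb_walk u u s -> last u s = u ->
  #|[set:: (u :: s) ++ (v :: t)]| <=
    #|[set:: walk_edges u s ++ walk_edges v t]|.+1.
Proof.
move=> s0 nbs lasts; have := closed_nb_walk_card s0 nbs lasts.
have EV e : e \in [set:: walk_edges u s] -> e \subset [set:: u :: s].
  rewrite inE /walk_edges {s0 nbs lasts}; elim: s u => [//|w s IH] u /=.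
  rewrite inE => /orP[/eqP ->|/IH /subset_trans]; last first.
    by apply; rewrite [in X in _ \subset X]set_cons subsetUr.
  by rewrite subUset !sub1set !inE !eqxx orbT.
have EV' e : e \in [set:: walk_edges u s] -> e \subset v |: [set:: u :: s].
  by move/EV/subset_trans; apply; apply: subsetUr.
have := walk_discovery t EV' (setU11 _ _).
rewrite !set_seq_cat set_cons (setUC [set v]) -setUA -(set_cons v t).
have := leq_card_setU [set:: u :: s] [set v]; rewrite cards1 addn1.
move=> leV disc leE; rewrite -(leq_add2r #|[set:: walk_edges u s]|).
apply: leq_trans disc _.
by rewrite addnC addSnnS leq_add2l -set_cons (leq_trans leV) // ltnS set_cons.
Qed.

Lemma leq_card_double_count (T : finType) (L : seq T) :
  (forall e, e \in L -> ~~ odd (count_mem e L)) -> 2 * #|[set:: L]| <= size L.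
Proof.
move=> ev; have -> : size L = \sum_(e in [set:: L]) count_mem e L.
  rewrite -sum1_size; under [RHS]eq_bigr do rewrite -sum1_count.
  rewrite (exchange_big_dep predT) //= big_seq_cond [RHS]big_seq_cond.
  apply: eq_bigr => e; rewrite andbT => eL.
  rewrite (big_pred1 e) // => f; rewrite inE /= eq_sym.
  by case: eqP => [->|]; rewrite ?eL ?andbF.
rewrite -sum1_card big_distrr /= leq_sum // => e; rewrite inE => eL.
by move: (ev e eL); rewrite -has_pred1 has_count in eL; case: count eL => [|[]].
Qed.

(** Such a tuple is determined by a list of [r + 1] values, padded with [x0], and the position of
    each entry in it. *)
Lemma card_tuple_few_values (T : finType) (x0 : T) (l r : nat) :
  #|[set f : l.-tuple T | #|[set:: f]| <= r.+1]| <= r.+1 ^ l * #|T| ^ r.+1.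
Proof.
pose F (p : l.-tuple 'I_r.+1 * r.+1.-tuple T) := [tuple of map (tnth p.2) p.1].
rewrite -card_tuple -[X in X ^ l]card_ord -card_tuple -card_prod.
apply: leq_trans (leq_imset_card F predT); apply: subset_leq_card.
apply/subsetP => f; rewrite inE => fr; apply/imsetP.
pose V := enum [set:: f].
exists ([tuple inord (index (tnth f i) V) | i < l],
  [tuple nth x0 V i | i < r.+1]).
  by [].
apply: eq_from_tnth => i; rewrite tnth_map !tnth_mktuple.
have fV : tnth f i \in V by rewrite mem_enum inE mem_tnth.
rewrite inordK ?nth_index // (leq_trans _ fr) // cardE -/V.
by rewrite index_mem.
Qed.

Local Open Scope ring_scope.

(** * Non-backtracking walk matrices *)

Lemma big_tuple_cons (V : nmodType) (T : finType) (k : nat) (P : pred (seq T))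
    (F : seq T -> V) :
  \sum_(t : k.+1.-tuple T | P t) F t =
  \sum_(w : T) \sum_(t : k.-tuple T | P (w :: t)) F (w :: t).
Proof.
rewrite pair_big_dep /=.
rewrite (reindex (fun p : T * k.-tuple T => cons_tuple p.1 p.2)) //=.
exists (fun t => (thead t, behead_tuple t)) => [[w t] _|t _] /=.
  by rewrite theadE; congr (_, _); apply: val_inj.
by rewrite [in RHS](tuple_eta t); apply: val_inj.
Qed.

Definition nb_sum (R : nzRingType) (n : nat) (w : {set 'I_n} -> R) (k : nat)
    (p u v : 'I_n) : R :=
  \sum_(t : k.-tuple 'I_n | nb_walk p u t && (last u t == v))
    \prod_(e <- walk_edges u t) w e.

Definition nb_mx (R : nzRingType) (n : nat) (w : {set 'I_n} -> R) (k : nat) :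
    'M[R]_n := \matrix_(u, v) nb_sum w k u u v.

Lemma nb_sum0 (R : nzRingType) (n : nat) (w : {set 'I_n} -> R) p u v :
  nb_sum w 0 p u v = (u == v)%:R.
Proof.
rewrite /nb_sum; have [->|uv] := eqVneq u v; last first.
  by rewrite big_pred0 // => t; rewrite tuple0 /=; apply/negbTE.
rewrite (big_pred1 [tuple]) ?big_nil // => t.
by rewrite (tuple0 t) /= !eqxx.
Qed.

Lemma nb_sumS (R : nzRingType) (n : nat) (w : {set 'I_n} -> R) k p u v :
  nb_sum w k.+1 p u v =
  \sum_(z | (z != p) && (z != u)) w [set u; z] * nb_sum w k u z v.
Proof.
rewrite /nb_sum (big_tuple_cons k (fun t => nb_walk p u t && (last u t == v))
  (fun t => \prod_(e <- walk_edges u t) w e)) /=.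
rewrite [RHS]big_mkcond /=; apply: eq_bigr => z _.
rewrite (eq_bigl (fun t : k.-tuple _ =>
  ((z != p) && (z != u)) && (nb_walk u z t && (last z t == v)))); last first.
  by move=> t; rewrite -!andbA.
case: ifP => _; last by rewrite big_pred0.
by rewrite big_distrr /=; apply: eq_bigr => t _; rewrite /walk_edges /= big_cons.
Qed.

Definition edge_weight_mx (R : nzRingType) (n : nat) (w : {set 'I_n} -> R) :=
  \matrix_(u, v) (if u == v then 0 else w [set u; v]) : 'M[R]_n.

Lemma nb_mx0 (R : nzRingType) (n : nat) (w : {set 'I_n} -> R) :
  nb_mx w 0 = 1%:M.
Proof. by apply/matrixP => u v; rewrite !mxE nb_sum0. Qed.

Lemma nb_mx1 (R : nzRingType) (n : nat) (w : {set 'I_n} -> R) :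
  nb_mx w 1 = edge_weight_mx w.
Proof.
apply/matrixP => u v; rewrite !mxE nb_sumS.
under eq_bigr do rewrite nb_sum0.
case: (u =P v) => [->|/eqP uv].
  by rewrite big1 // => z /andP[/negPf -> _]; rewrite mulr0.
rewrite (bigD1 v) /=; last by rewrite eq_sym uv.
by rewrite eqxx mulr1 big1 ?addr0 // => z /andP[_ /negPf ->]; rewrite mulr0.
Qed.

(** A step from [u] to [z] followed by a walk either stays non-backtracking or returns to [u] at
    once; in the second case the two equal weights cancel, and the rest avoids [z] first. *)
Lemma mul_edge_weight_nb_mx (R : nzRingType) (n : nat) (w : {set 'I_n} -> R) k :
  (forall u v, u != v -> w [set u; v] * w [set u; v] = 1) ->
  edge_weight_mx w *m nb_mx w k.+1 =
  nb_mx w k.+2 + \matrix_(u, v) \sum_(z | z != u) nb_sum w k z u v.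
Proof.
move=> w2; apply/matrixP => u v; rewrite !mxE nb_sumS.
under [X in _ = X + _]eq_bigl do rewrite andbb.
rewrite -big_split /= [RHS]big_mkcond /=; apply: eq_bigr => z _.
rewrite !mxE eq_sym; case: (eqVneq z u) => [_|zu /=]; first by rewrite mul0r.
rewrite nb_sumS; under eq_bigl do rewrite andbb.
rewrite (bigD1 u) /=; last by rewrite eq_sym.
rewrite mulrDr mulrA (setUC [set z]) w2 1?eq_sym // mul1r [RHS]addrC.
by rewrite nb_sumS; congr (_ + _ * _); apply: eq_bigl => x; rewrite andbC.
Qed.

Lemma nb_mx_rec2 (R : nzRingType) (n : nat) (w : {set 'I_n} -> R) :
  (forall u v, u != v -> w [set u; v] * w [set u; v] = 1) ->
  edge_weight_mx w *m nb_mx w 1 = nb_mx w 2 + (n.-1)%:R%:M.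
Proof.
move=> w2; rewrite mul_edge_weight_nb_mx //; congr (_ + _).
apply/matrixP => u v; rewrite !mxE; under eq_bigr do rewrite nb_sum0.
rewrite sumr_const cardC1 card_ord.
by case: eqP => //=; rewrite mul0rn.
Qed.

(** A walk of positive length from [u] is counted once for each forbidden [z] other than [u] and its
    next vertex, so [n - 2] times; the empty walk in [nb_mx_rec2] has no next vertex, whence
    [n - 1]. *)
Lemma nb_mx_rec (R : nzRingType) (n : nat) (w : {set 'I_n} -> R) k :
  (forall u v, u != v -> w [set u; v] * w [set u; v] = 1) ->
  edge_weight_mx w *m nb_mx w k.+2 = nb_mx w k.+3 + (n.-2)%:R *: nb_mx w k.+1.
Proof.
move=> w2; rewrite mul_edge_weight_nb_mx //; congr (_ + _).
apply/matrixP => u v; rewrite !mxE; under eq_bigr do rewrite nb_sumS.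
rewrite (exchange_big_dep (fun z => z != u)) /=; last by move=> ? ? _ /andP[].
rewrite nb_sumS; under [in RHS]eq_bigl do rewrite andbb.
rewrite big_distrr /=; apply: eq_bigr => z zu.
rewrite sumr_const mulr_natl; congr (_ *+ _).
rewrite (eq_card (B := [predC pred2 u z])); last first.
  by move=> x; rewrite !inE negb_or unfold_in /= (eq_sym z x) zu ?andbT.
have := cardC (pred2 u z); rewrite card2 eq_sym zu card_ord => En.
by move: #|_| En => m; clear; lia.
Qed.

(** * Second moments of the traces *)

Definition edge_sign (R : nzRingType) (n : nat) (G : simple_graph n)
    (tau : signing G) (e : {set 'I_n}) : R :=
  if insub e is Some f then (-1) ^+ tau f else 0.

Definition flip_sign (n : nat) (G : simple_graph n) (f : edge G)
    (tau : signing G) : signing G := [ffun g => tau g (+) (g == f)].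

Lemma flip_signK (n : nat) (G : simple_graph n) (f : edge G) :
  involutive (flip_sign f).
Proof. by move=> tau; apply/ffunP => g; rewrite !ffunE addbK. Qed.

Lemma edge_sign_flip (R : nzRingType) (n : nat) (G : simple_graph n)
    (f : edge G) (tau : signing G) (e : {set 'I_n}) :
  edge_sign R (flip_sign f tau) e = (-1) ^+ (e == val f) * edge_sign R tau e.
Proof.
rewrite /edge_sign; case: insubP => [g _ ge|]; last by rewrite mulr0.
by rewrite ffunE -val_eqE /= ge -signr_addb addbC.
Qed.

Lemma prod_edge_sign_flip (R : comNzRingType) (n : nat) (G : simple_graph n)
    (f : edge G) (tau : signing G) (L : seq {set 'I_n}) :
  \prod_(e <- L) edge_sign R (flip_sign f tau) e =
  (-1) ^+ count_mem (val f) L * \prod_(e <- L) edge_sign R tau e.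
Proof.
elim: L => [|e L IH]; first by rewrite !big_nil mulr1.
by rewrite !big_cons IH edge_sign_flip /= exprD mulrACA.
Qed.

(** Flipping the sign of an edge of odd multiplicity negates the product, so the sum equals its
    opposite. A set that is not an edge makes the product vanish. *)
Lemma sum_prod_edge_sign_le (R : realDomainType) (n : nat) (G : simple_graph n)
    (L : seq {set 'I_n}) :
  \sum_(tau : signing G) \prod_(e <- L) edge_sign R tau e <=
  #|signing G|%:R * (all (fun e => ~~ odd (count_mem e L)) L)%:R.
Proof.
have [_|] := boolP (all _ L).
  rewrite mulr1 -sum1_card natr_sum ler_sum // => tau _.
  rewrite (le_trans (ler_norm _)) // normr_prod.
  elim: L => [|e L IH]; first by rewrite big_nil.
  rewrite big_cons mulr_ile1 ?normr_ge0 ?prodr_ge0 //.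
  rewrite /edge_sign; case: insub => [f|]; last by rewrite normr0.
  by rewrite normrX normrN1 expr1n.
rewrite -has_predC => /hasP[e eL /=]; rewrite negbK mulr0 => odd_e.
rewrite le_eqVlt; apply/orP; left; apply/eqP.
case Ee : (insub e : option (edge G)) => [f|]; last first.
  apply: big1 => tau _; rewrite (big_rem e) //=.
  by rewrite {1}/edge_sign Ee mul0r.
have fe : val f = e by move: Ee; case: insubP => // g _ ge [<-].
set S := \sum_tau _.
suff : S = - S by move/eqP; rewrite -addr_eq0 -mulr2n mulrn_eq0 => /eqP.
rewrite {1}/S (reindex_inj (inv_inj (flip_signK f))) /= -sumrN.
apply: eq_bigr => tau _.
by rewrite prod_edge_sign_flip fe -signr_odd odd_e mulN1r.
Qed.

Definition closed_nb (n k : nat) (c : 'I_n * k.-tuple 'I_n) : bool :=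
  nb_walk c.1 c.1 c.2 && (last c.1 c.2 == c.1).

Lemma trace_nb_mx (R : nzRingType) (n : nat) (w : {set 'I_n} -> R) k :
  \tr (nb_mx w k) =
  \sum_(c | closed_nb c) \prod_(e <- walk_edges c.1 (c.2 : k.-tuple _)) w e.
Proof.
rewrite /mxtrace; under eq_bigr do rewrite mxE /nb_sum.
by rewrite pair_big_dep.
Qed.

Lemma size_walk_edges (T : finType) (u : T) (t : seq T) :
  size (walk_edges u t) = size t.
Proof. by rewrite size_pairmap. Qed.

(** The [2 (k + 1)] steps use at most [k + 1] distinct edges, hence at most [k + 2] vertices. *)
Lemma card_even_closed_nb_pairs (n k : nat) :
  (#|[set c : ('I_n * k.+1.-tuple 'I_n) * ('I_n * k.+1.-tuple 'I_n) |
      [&& closed_nb c.1, closed_nb c.2 &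
       let L := walk_edges c.1.1 c.1.2 ++ walk_edges c.2.1 c.2.2 in
       all (fun e => ~~ odd (count_mem e L)) L]]| <=
   k.+2 ^ (k.+2 + k.+2) * n ^ k.+2)%N.
Proof.
case: n => [|n].
  by rewrite eq_card0 // => -[[[]]].
pose F (c : ('I_n.+1 * k.+1.-tuple 'I_n.+1) * ('I_n.+1 * k.+1.-tuple 'I_n.+1)) :=
  [tuple of (c.1.1 :: c.1.2) ++ (c.2.1 :: c.2.2)].
have Finj : injective F.
  move=> [[u s] [v t]] [[u' s'] [v' t']] /(congr1 val) /eqP /=.
  rewrite -!cat_cons eqseq_cat /= ?size_tuple // => /andP[].
  rewrite !eqseq_cons => /andP[/eqP -> /eqP /val_inj ->].
  by move=> /andP[/eqP -> /eqP /val_inj ->].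
rewrite -(card_imset _ Finj).
apply: leq_trans (_ : _ <= k.+2 ^ (k.+2 + k.+2) * #|'I_n.+1| ^ k.+2)%N _;
  last by rewrite card_ord.
apply: leq_trans (card_tuple_few_values (ord0 : 'I_n.+1) _ _).
apply/subset_leq_card/subsetP => f /imsetP[[[u s] [v t]]].
rewrite inE /= => /and3P[/andP[nbs /eqP lasts] _ /allP even] ->; rewrite inE /=.
apply: leq_trans (nb_walk_pair_card v t _ nbs lasts) _; first by rewrite size_tuple.
rewrite ltnS; have := leq_card_double_count even.
rewrite size_cat !size_walk_edges !size_tuple addnn -mul2n leq_pmul2l //.
Qed.

Lemma trace_nb_mx_second_moment (R : realDomainType) (n : nat)
    (G : simple_graph n) (k : nat) :
  \sum_(tau : signing G) \tr (nb_mx (edge_sign R tau) k.+1) ^+ 2 <=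
  #|signing G|%:R * (k.+2 ^ (k.+2 + k.+2) * n ^ k.+2)%:R.
Proof.
pose L (c : ('I_n * k.+1.-tuple 'I_n) * ('I_n * k.+1.-tuple 'I_n)) :=
  walk_edges c.1.1 c.1.2 ++ walk_edges c.2.1 c.2.2.
have -> : \sum_(tau : signing G) \tr (nb_mx (edge_sign R tau) k.+1) ^+ 2 =
    \sum_(c | closed_nb c.1 && closed_nb c.2)
      \sum_(tau : signing G) \prod_(e <- L c) edge_sign R tau e.
  rewrite exchange_big /=; apply: eq_bigr => tau _.
  rewrite expr2 trace_nb_mx big_distrlr /= pair_big_dep /=.
  by apply: eq_bigr => c _; rewrite /L big_cat.
apply: le_trans (ler_sum _ (fun c _ => sum_prod_edge_sign_le _ _ (L c))) _.
rewrite -big_distrr /= ler_wpM2l ?ler0n // -natr_sum ler_nat.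
apply: leq_trans (card_even_closed_nb_pairs n k).
rewrite -sum1_card big_mkcond [X in (_ <= X)%N]big_mkcond /=.
apply: leq_sum => c _; rewrite inE -/(L c) andbA.
by case: ifP => //= _; case: all.
Qed.

(** * Spectra of symmetric matrices *)

Lemma char_poly_conj (F : fieldType) (n : nat) (P D : 'M[F]_n) :
  P \in unitmx -> char_poly (invmx P *m D *m P) = char_poly D.
Proof.
move=> Pu; rewrite /char_poly.
have PP : map_mx polyC (invmx P) *m map_mx polyC P = 1%:M.
  by rewrite -map_mxM mulVmx // map_mx1.
have -> : char_poly_mx (invmx P *m D *m P) =
    map_mx polyC (invmx P) *m char_poly_mx D *m map_mx polyC P.
  rewrite /char_poly_mx mulmxBr mulmxBl !map_mxM; congr (_ - _).
  by rewrite mul_mx_scalar -scalemxAl PP scalemx1.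
by rewrite !det_mulmx mulrAC -det_mulmx PP det1 mul1r.
Qed.

(** The spectral theorem is applied over [R[i]]; the diagonal is real and the embedding injective,
    so the identities descend to [R]. *)
Lemma symmetric_spectrum (R : rcfType) (n : nat) (A : 'M[R]_n.+1) :
  A^T = A -> exists t : n.+1.-tuple R,
  [/\ sorted >=%R t, char_poly A = \prod_(x <- t) ('X - x%:P) &
      forall q, \tr (horner_mx A q) = \sum_(x <- t) q.[x]].
Proof.
move=> Asym; pose f : {rmorphism R -> R[i]} := real_complex R.
pose B := map_mx f A.
have Breal : B \is a mxOver Num.real.
  by apply/mxOverP => i j; rewrite mxE complex_real.
have Bsym : B \is symmetricmx.
  by apply/is_hermitianmxP; rewrite expr0 scale1r map_mx_id // map_trmx Asym.
have Bherm := realsym_hermsym Bsym Breal.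
have /orthomx_spectralP BE := hermitian_normalmx Bherm.
have /mxOverP dreal := hermitian_spectral_diag_real Bherm.
pose d := \row_j complex.Re (spectral_diag B 0 j).
have dE : spectral_diag B = map_mx f d.
  by apply/rowP => j; rewrite !mxE; case/complex_realP: (dreal 0 j) => k ->.
have Punit := spectral_unit B; move: BE Punit; rewrite dE; set P := spectralmx B.
move=> BE Punit.
pose s := sort >=%R [seq d 0 j | j <- enum 'I_n.+1].
have sperm : perm_eq s [seq d 0 j | j <- enum 'I_n.+1] by rewrite perm_sort.
have ssize : size s == n.+1 by rewrite size_sort size_map size_enum_ord.
have finj : injective f by apply: fmorph_inj.
exists (Tuple ssize); split => /=.
- by apply: sort_sorted => x y; exact: le_total.
- apply: (map_poly_inj f); rewrite map_char_poly -/B.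
  rewrite (perm_big _ sperm) big_map big_enum /= rmorph_prod /= BE.
  rewrite char_poly_conj // char_poly_trig ?diag_mx_is_trig //.
  by apply: eq_bigr => i _; rewrite !mxE eqxx map_polyXsubC.
- move=> q; apply: finj; rewrite -trace_map_mx map_horner_mx -/B BE.
  rewrite horner_mx_uconjC // mxtrace_mulC mulmxA mulmxV // mul1mx.
  rewrite horner_mx_diag mxtrace_diag (perm_big _ sperm) big_map big_enum.
  by rewrite rmorph_sum; apply: eq_bigr => i _; rewrite !mxE horner_map.
Qed.

(** * The signed complete graph *)

(* The Chebyshev recursion for [a = b = 1]; the walk matrices on [n] vertices have
   [a = n - 1] and [b = n - 2]. *)
Fixpoint nb_rec (S : nzRingType) (a b x : S) (k : nat) : S :=
  if k isn't k1.+1 then 1 else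
  if k1 isn't k2.+1 then x else
  x * nb_rec a b x k1 - (if k2 is 0%N then a else b) * nb_rec a b x k2.

Lemma nb_rec_ind (S : nzRingType) (a b x : S) (P : nat -> S -> Prop) :
  P 0%N 1 -> P 1%N x ->
  (forall k u v, P k u -> P k.+1 v ->
     P k.+2 (x * v - (if k is 0%N then a else b) * u)) ->
  forall k, P k (nb_rec a b x k).
Proof.
move=> P0 P1 PS k.
suff: P k (nb_rec a b x k) /\ P k.+1 (nb_rec a b x k.+1) by case.
by elim: k => [//|k [IH IH1]]; split=> //; apply: PS.
Qed.

Lemma rmorph_nb_rec (S S' : nzRingType) (f : {rmorphism S -> S'}) (a b x : S) k :
  f (nb_rec a b x k) = nb_rec (f a) (f b) (f x) k.
Proof.
apply: (nb_rec_ind (P := fun k u => f u = nb_rec (f a) (f b) (f x) k)) => //=.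
  exact: rmorph1.
by move=> {}k u v <- <-; rewrite rmorphB !rmorphM; case: k.
Qed.

Lemma nb_rec_scale (S : comNzRingType) (s a b x : S) k :
  nb_rec (s ^+ 2 * a) (s ^+ 2 * b) (s * x) k = s ^+ k * nb_rec a b x k.
Proof.
apply: (nb_rec_ind (P := fun k u => u = s ^+ k * nb_rec a b x k)) => //=.
  by rewrite mulr1.
by move=> {}k u v -> ->; case: k => [|k]; rewrite !exprS; ring.
Qed.

(** From here on there are [n + 1] vertices, so the recursion has [a = n] and [b = n - 1]. *)
Lemma nb_mxE (R : nzRingType) (n : nat) (w : {set 'I_n.+1} -> R) k :
  (forall u v, u != v -> w [set u; v] * w [set u; v] = 1) ->
  nb_mx w k = nb_rec n%:R%:M n.-1%:R%:M (edge_weight_mx w) k.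
Proof.
move=> w2; apply: (nb_rec_ind (P := fun k M => nb_mx w k = M)).
- exact: nb_mx0.
- exact: nb_mx1.
case=> [|{}k] M M' <- <-; apply/eqP; rewrite eq_sym subr_eq; apply/eqP.
  by have := nb_mx_rec2 w2; rewrite nb_mx0 mulr1.
by have := nb_mx_rec k w2; rewrite -mul_scalar_mx.
Qed.

Lemma degree_complete (n : nat) (v : 'I_n) : degree (complete_graph n) v = n.-1.
Proof.
rewrite /degree -[in RHS](card_ord n) -(cardsC1 v); apply: eq_card => w.
by rewrite !inE eq_sym.
Qed.

Lemma edge_set_complete (n : nat) (u v : 'I_n) :
  ([set u; v] \in edge_set (complete_graph n)) = (u != v).
Proof.
apply/imsetP/idP => [[[x y]]|uv]; last by exists (u, v); rewrite ?inE.
rewrite inE /= => xy uvxy; apply: contraNneq xy => uv.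
have : #|[set x; y]| = 1%N by rewrite -uvxy uv setUid cards1.
by rewrite cards2; case: eqP.
Qed.

Lemma edge_sign_complete_loop (R : nzRingType) (n : nat)
    (tau : signing (complete_graph n)) (u : 'I_n) :
  edge_sign R tau [set u; u] = 0.
Proof. by rewrite /edge_sign insubF // edge_set_complete eqxx. Qed.

Lemma edge_sign_complete_sqr (R : nzRingType) (n : nat)
    (tau : signing (complete_graph n)) (u v : 'I_n) :
  u != v -> edge_sign R tau [set u; v] * edge_sign R tau [set u; v] = 1.
Proof.
rewrite /edge_sign -edge_set_complete => uv; rewrite insubT.
by rewrite -expr2 sqrr_sign.
Qed.

Lemma signed_laplacian_complete (R : nzRingType) (n : nat)
    (tau : signing (complete_graph n.+1)) :
  signed_laplacian R tau = n%:R%:M - edge_weight_mx (edge_sign R tau).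
Proof.
apply/matrixP => u v; rewrite !mxE degree_complete /=; congr (_ - _).
by have [->|//] := eqVneq u v; exact: edge_sign_complete_loop.
Qed.

Lemma signed_laplacian_complete_sym (R : nzRingType) (n : nat)
    (tau : signing (complete_graph n.+1)) :
  (signed_laplacian R tau)^T = signed_laplacian R tau.
Proof.
rewrite signed_laplacian_complete linearB /= tr_scalar_mx; congr (_ - _).
by apply/matrixP => u v; rewrite !mxE eq_sym setUC.
Qed.

Lemma nb_mx_laplacian (R : fieldType) (n : nat)
    (tau : signing (complete_graph n.+1)) (k : nat) :
  nb_mx (edge_sign R tau) k =
  horner_mx (signed_laplacian R tau)
    (nb_rec n%:R%:P n.-1%:R%:P (n%:R%:P - 'X) k).
Proof.
rewrite nb_mxE; last exact: edge_sign_complete_sqr.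
rewrite (rmorph_nb_rec (horner_mx (signed_laplacian R tau))) /= rmorphB /=.
by rewrite !horner_mx_C horner_mx_X signed_laplacian_complete opprB addrC subrK.
Qed.

(** * The certificate polynomial *)

(* The square in the certificate is that of [U_0 + 2 U_1 + 2 U_2 + U_3]: the weights
   [1, 2, 2, 1] approximate the top eigenvector of the path on four vertices, whose
   eigenvalue [2 cos (pi / 5) > 31 / 20] is the best threshold that a cubic gives.
   The parameter [r] stands for [1 / (n - 2)], the correction in the first step of
   the walk recursion. *)
Definition certificate_coef (R : nzRingType) (r : R) : seq R :=
  [:: 56 + 600 * r + 648 * r ^+ 2 + 394 * r ^+ 3 - 20 * r ^+ 4;
      357 + 706 * r + 630 * r ^+ 2 + 151 * r ^+ 3;
      600 + 648 * r + 394 * r ^+ 2 - 20 * r ^+ 3;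
      706 + 630 * r + 151 * r ^+ 2;
      648 + 394 * r - 20 * r ^+ 2;
      630 + 151 * r;
      394 - 20 * r;
      151;
      - 20].

Lemma certificate_expansion (R : fieldType) (r x : R) :
  (20 * x - 31) * (10 - x) * (x ^+ 3 + 2 * x ^+ 2 - 1) ^+ 2 =
  \sum_(k < 9) (certificate_coef r)`_k * nb_rec (1 + r) 1 x k.
Proof.
by rewrite !big_ord_recl big_ord0 /certificate_coef /nb_rec /=; ring.
Qed.

Lemma certificate_coef_bound (R : realFieldType) (r : R) :
  0 <= r <= 1 -> 56 <= (certificate_coef r)`_0 /\
  forall k, `|(certificate_coef r)`_k.+1| <= 2000.
Proof.
move=> /andP[r0 r1].
have /andP[r20 r21] : 0 <= r ^+ 2 <= 1 by rewrite exprn_ge0 // exprn_ile1.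
have /andP[r30 r31] : 0 <= r ^+ 3 <= 1 by rewrite exprn_ge0 // exprn_ile1.
(* With [r ^+ 4 <= r], the term [600 * r] absorbs [- 20 * r ^+ 4]. *)
have /andP[r40 r41] : 0 <= r ^+ 4 <= r.
  by rewrite exprn_ge0 // exprS ler_piMr // exprn_ile1.
split=> [|k]; first by rewrite /certificate_coef /=; lra.
do 8?[case: k => [|k]; first by rewrite /certificate_coef /= ler_norml; lra].
by rewrite nth_default //= normr0; lra.
Qed.

(** The factor [10 - x] makes the polynomial nonpositive beyond 10 as well, so only
    [31 / 20 < x <= 10] needs a bound. *)
Lemma certificate_bounded (R : realFieldType) : exists2 K : R, 2 <= K &
  forall x, (20 * x - 31) * (10 - x) * (x ^+ 3 + 2 * x ^+ 2 - 1) ^+ 2 <=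
            K * (31 / 20 < x)%R%:R.
Proof.
have [c c1 c2] : exists2 c : R, 1 <= c & 10 ^+ 3 + 2 * 10 ^+ 2 <= c.
  exists (1 + (10 ^+ 3 + 2 * 10 ^+ 2)); rewrite ?lerDl ?lerDr //.
  by rewrite addr_ge0 ?mulr_ge0 ?exprn_ge0.
have c21 : 1 <= c ^+ 2 by exact: exprn_ege1.
exists (200 * 10 * c ^+ 2) => [|x]; first by lra.
have sq := sqr_ge0 (x ^+ 3 + 2 * x ^+ 2 - 1).
have [x1|x1] := ltP; last first.
  rewrite mulr0; apply: mulr_le0_ge0 => //; nra.
rewrite mulr1; have [x2|x2] := leP x 10; last first.
  apply: le_trans (_ : 0 <= _); first by apply: mulr_le0_ge0 => //; nra.
  by lra.
have x3 : 0 <= x ^+ 3 by rewrite exprn_ge0; lra.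
have x3' : x ^+ 3 <= 10 ^+ 3 by apply: lerXn2r; rewrite ?nnegrE; lra.
have x4 : 1 <= x ^+ 2 by nra.
have x4' : x ^+ 2 <= 10 ^+ 2 by apply: lerXn2r; rewrite ?nnegrE; lra.
apply: ler_pM; rewrite ?sqr_ge0 //; first by nra.
  by apply: ler_pM; lra.
by apply: lerXn2r; rewrite ?nnegrE; lra.
Qed.

(** * Sums of the largest entries of a sorted sequence *)

Lemma count_sorted_nth_lt (R : realDomainType) (t : seq R) (theta : R) (m i : nat) :
  sorted >=%R t -> (m <= count (< theta) t)%N -> (size t - m <= i < size t)%N ->
  t`_i < theta.
Proof.
move=> srt mt /andP[mi it]; rewrite ltNge; apply/negP => ti.
move: mt; rewrite -(cat_take_drop i.+1 t) count_cat.
(* If entry [i] reaches [theta], so do all entries before it, and fewer than [m] remain. *)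
have /eqP -> : count (< theta) (take i.+1 t) == 0%N.
  rewrite -leqn0 leqNgt -has_count; apply/hasPn => x /(nthP 0)[j].
  rewrite size_takel // => ji <-; rewrite nth_take // /= -leNgt.
  apply: le_trans ti _.
  apply: (sorted_leq_nth (leT := >=%R)) => //.
  - by move=> ? ? ? /= h1 h2; exact: le_trans h2 h1.
  - exact: lexx.
  - by rewrite inE (leq_trans ji).
rewrite add0n => /leq_trans /(_ (count_size _ _)); rewrite size_drop => ms.
by move: mi it ms; clear; move: (size t) => sz; lia.
Qed.

Lemma sum_top_ge (R : realDomainType) (t : seq R) (theta : R) (m : nat) :
  sorted >=%R t -> (m <= count (< theta) t)%N ->
  \sum_(x <- t) x - m%:R * theta <= \sum_(0 <= i < size t - m) t`_i.
Proof.
move=> srt mt; have mn := leq_trans mt (count_size _ _).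
rewrite lerBlDr (big_nth 0) (big_cat_nat _ (n := (size t - m)%N)) ?leq_subr //=.
rewrite lerD2l -[X in X%:R](subKn mn) mulr_natl -sumr_const_nat.
rewrite big_nat_cond [leRHS]big_nat_cond; apply: ler_sum => i /andP[im _].
exact/ltW/(count_sorted_nth_lt srt mt).
Qed.

(* Imported only here: the set lemmas of all_classical shadow those of finset. *)
From mathcomp Require Import all_classical all_reals all_analysis.
Import Order.TTheory GRing.Theory Num.Theory.
Import numFieldNormedType.Exports.

(** * Large eigenvalues *)

(** The constant term gives a mean of at least 56, and each of the other eight terms costs at most
    [2000 * d <= 2]. *)
Lemma certificate_sum_ge (R : realFieldType) (I : Type) (l : seq I) (x : I -> R)
    (r d : R) :
  0 <= r <= 1 -> 2000 * d <= 2 ->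
  (forall k, (0 < k <= 8)%N ->
     `|\sum_(i <- l) nb_rec (1 + r) 1 (x i) k| <= d * (size l)%:R) ->
  (size l)%:R <=
  \sum_(i <- l) (20 * x i - 31) * (10 - x i) * (x i ^+ 3 + 2 * x i ^+ 2 - 1) ^+ 2.
Proof.
move=> r01 d2 small; have [c0 cS] := certificate_coef_bound r01.
under eq_bigr do rewrite (certificate_expansion r).
rewrite exchange_big /=; under eq_bigr do rewrite -mulr_sumr.
rewrite big_ord_recl big_const_seq count_predT iter_addr_0.
set N : R := (size l)%:R; have N0 : 0 <= N by rewrite ler0n.
have low k : (k < 8)%N -> - (2 * N) <= (certificate_coef r)`_k.+1 *
    \sum_(i <- l) nb_rec (1 + r) 1 (x i) k.+1.
  move=> k8; set T := \sum_(i <- l) _.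
  have : `|(certificate_coef r)`_k.+1 * T| <= 2000 * (d * N).
    by rewrite normrM ler_pM // small.
  rewrite ler_norml => /andP[+ _]; apply: le_trans.
  by rewrite lerN2 mulrA ler_wpM2r.
have : \sum_(k < 8) - (2 * N) <= \sum_(k < 8) (certificate_coef r)`_(lift ord0 k) *
    \sum_(i <- l) nb_rec (1 + r) 1 (x i) (lift ord0 k).
  by apply: ler_sum => k _; apply: low.
rewrite sumr_const card_ord -mulr_natl.
have : 56 * N <= (certificate_coef r)`_0 * N by rewrite ler_wpM2r.
set S := \sum_(k < 8) _; set C := (_)`_0 * N; move=> CN SN.
by change (N <= C + S); lra.
Qed.

Lemma nb_trace_eigen (R : rcfType) (n : nat) (tau : signing (complete_graph n.+1))
    (t : n.+1.-tuple R) (s : R) (k : nat) :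
  (forall q, \tr (horner_mx (signed_laplacian R tau) q) = \sum_(y <- t) q.[y]) ->
  0 < s -> s ^+ 2 = n%:R - 1 ->
  \tr (nb_mx (edge_sign R tau) k) =
  s ^+ k * \sum_(y <- t) nb_rec (1 + s ^- 2) 1 ((n%:R - y) / s) k.
Proof.
move=> trt s0 s2; rewrite nb_mx_laplacian trt mulr_sumr.
apply: eq_bigr => y _; rewrite -nb_rec_scale.
have sn : s != 0 by rewrite gt_eqF.
have n0 : n%:R - 1 != 0 :> R by rewrite -s2 expf_neq0.
rewrite -[LHS]/(horner_eval y _) rmorph_nb_rec /= !horner_evalE.
congr nb_rec.
- by rewrite hornerC mulrDr mulr1 mulfV ?expf_neq0 // s2 subrK.
(* For [n = 0] the truncated [n.-1] differs from [n - 1], but then [s ^+ 2] would be negative. *)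
- rewrite hornerC mulr1 s2; case: (n) (s2) => [s2'|m _]; last by rewrite -natr1 addrK.
  by have := exprn_gt0 2 s0; rewrite s2'; lra.
- by rewrite hornerD hornerN hornerC hornerX mulrC divfK.
Qed.

Lemma bin2R (R : numFieldType) (n : nat) :
  'C(n.+1, 2)%:R = n.+1%:R * n%:R / 2 :> R.
Proof.
have := congr1 (fun m => m%:R : R) (mul_bin_diag n.+1 1).
by rewrite /= bin1 !natrM => ->; rewrite [2 * _]mulrC mulfK ?pnatr_eq0.
Qed.

Lemma good_signing (R : realType) (n : nat) (tau : signing (complete_graph n.+1))
    (K d s : R) :
  2 <= K -> 2000 * d <= 2 ->
  (forall x, (20 * x - 31) * (10 - x) * (x ^+ 3 + 2 * x ^+ 2 - 1) ^+ 2 <=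
             K * (31 / 20 < x)%R%:R) ->
  s ^+ 2 = n%:R - 1 -> K <= s ->
  (forall k, (0 < k <= 8)%N ->
    `|\tr (nb_mx (edge_sign R tau) k)| <= s ^+ k * (d * n.+1%:R)) ->
  exists2 t : n.+1.-tuple R,
    ordered_eigenvalues (signed_laplacian R tau) t &
    exists2 k : nat, (1 <= k <= n.+1)%N &
      \sum_(1 <= j < k.+1) t`_(j.-1) > 'C(n.+1, 2)%:R + 'C(k.+1, 2)%:R.
Proof.
move=> K2 d2 certK s2 sK small.
have s0 : 0 < s by lra.
have [t [srt cp trt]] := symmetric_spectrum (signed_laplacian_complete_sym R tau).
exists t; first by [].
pose x y : R := (n%:R - y) / s.
have r01 : 0 <= s ^- 2 <= 1.
  have s21 : 1 <= s ^+ 2 by apply: exprn_ege1; lra.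
  have s20 : 0 < s ^+ 2 by lra.
  by rewrite invr_ge0 ltW // invf_le1.
have cert : n.+1%:R <= K * (count (fun y => 31 / 20 < x y) t)%:R.
  have /= := @certificate_sum_ge R R t x _ d r01 d2; rewrite size_tuple => H.
  apply: le_trans (H _) _.
    move=> k k8; have := small k k8; rewrite (nb_trace_eigen k trt s0 s2).
    by rewrite normrM gtr0_norm ?exprn_gt0 // ler_pM2l ?exprn_gt0.
  apply: le_trans (ler_sum _ (fun y _ => certK (x y))) _.
  by rewrite -mulr_sumr -natr_sum -sum1_count [in leRHS]big_mkcond.
clear d2 small; have [m sm ms] : exists2 m : nat, s < m%:R & m%:R <= s + 1.
  (* [m] is the integer part of [s] plus one. *)
  have /andP[s1 s1'] := truncn_itv (ltW s0).
  by exists (Num.truncn s).+1 => //; rewrite -natr1 lerD2r.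
pose theta := n%:R - 31 / 20 * s.
(* Eigenvalues of the adjacency matrix above [31 / 20 * s] are Laplacian eigenvalues below
   [theta]. *)
have eqc : count (fun y => 31 / 20 < x y) t = count (< theta) t.
  apply: eq_count => y /=; rewrite /x ltr_pdivlMr // /theta; lra.
have mc : (m <= count (< theta) t)%N.
  rewrite leqNgt; apply/negP => cm; move: cert; rewrite eqc.
  (* A count below [m] is at most [s], so with [K <= s] it would give [n + 1 <= s ^+ 2 = n - 1]. *)
  have cs : (count (< theta) t)%:R <= s.
    by rewrite -(lerD2r 1) natr1; apply: le_trans ms; rewrite ler_nat.
  have : K * (count (< theta) t)%:R <= s ^+ 2 by rewrite expr2 ler_pM //; lra.
  by rewrite s2 -natr1; lra.
have mn : (m < n.+1)%N.
  by rewrite -(ltr_nat R) -natr1; nra.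
have := sum_top_ge srt mc; rewrite size_tuple.
have -> : \sum_(y <- t) y = n.+1%:R * n%:R.
  have := trt 'X; rewrite horner_mx_X => /esym; under eq_bigr do rewrite hornerX.
  move=> ->; rewrite signed_laplacian_complete /mxtrace.
  under eq_bigr do rewrite !mxE eqxx subr0.
  by rewrite sumr_const card_ord mulr_natl.
move=> top; exists (n.+1 - m)%N; first by rewrite subn_gt0 mn leq_subr.
rewrite big_add1 /= (lt_le_trans _ top) // !bin2R.
rewrite -[(n.+1 - m).+1%:R]natr1 natrB; last exact: ltnW.
rewrite /theta -[n.+1%:R]natr1.
have nE : n%:R = s ^+ 2 + 1 by rewrite s2 subrK.
rewrite nE; move: (m%:R) sm ms => M sM Ms.
(* What remains is [31 / 20 * M * s + 3 / 2 * M > M ^+ 2 / 2 + s ^+ 2 + 2]. For [M] near [s] the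
   quadratic terms leave [(31 / 20 - 3 / 2) * s ^+ 2], so a threshold above [3 / 2] is what
   matters. *)
have : 0 <= (M - s) * (s + 1 - M) by rewrite mulr_ge0 //; lra.
have : 0 <= s * (M - s) by rewrite mulr_ge0 //; lra.
have : 0 <= s ^+ 2 by exact: sqr_ge0.
lra.
Qed.

(** * Probability estimates *)

Lemma equiprob_le1 (R : realType) (T : finType) (P : T -> Prop) :
  equiprob R P <= 1.
Proof.
rewrite /equiprob; have [->|T0] := posnP #|T|; first by rewrite invr0 mulr0.
by rewrite ler_pdivrMr ?ltr0n // mul1r ler_nat max_card.
Qed.

(** Markov's inequality: [Y] is at least 1 wherever [P] fails. *)
Lemma equiprob_markov (R : realType) (T : finType) (P : T -> Prop) (Y : T -> R) :
  (0 < #|T|)%N -> (forall x, 0 <= Y x) -> (forall x, Y x < 1 -> P x) ->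
  1 - (\sum_x Y x) / #|T|%:R <= equiprob R P.
Proof.
move=> T0 Y0 YP; rewrite lerBlDr /equiprob -mulrDl ler_pdivlMr ?ltr0n // mul1r.
have -> : #|T|%:R = \sum_(x : T) 1 :> R by rewrite sumr_const.
rewrite -sum1_card natr_sum [X in _ <= X + _]big_mkcond /= -big_split /=.
apply: ler_sum => x _; rewrite inE; case: asboolP => [_|nP].
  by rewrite lerDl.
by rewrite add0r leNgt; apply/negP => /YP.
Qed.

(** Bounds [n + 1] times the mean of [Y] in [equiprob_good_ge]; the powers of 2 come from
    [n + 1 <= 2 * s ^+ 2]. *)
Definition moment_const (R : unitRingType) (d : R) : R :=
  \sum_(k < 8) d ^- 2 * 2 ^+ k.+1 * (k.+2 ^ (k.+2 + k.+2))%:R.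

Lemma equiprob_good_ge (R : realType) (n : nat) (K d s : R) :
  2 <= K -> 0 < d -> 2000 * d <= 2 ->
  (forall x, (20 * x - 31) * (10 - x) * (x ^+ 3 + 2 * x ^+ 2 - 1) ^+ 2 <=
             K * (31 / 20 < x)%R%:R) ->
  s ^+ 2 = n%:R - 1 -> K <= s -> (2 < n)%N ->
  1 - moment_const d / n.+1%:R <=
  equiprob R (fun tau : signing (complete_graph n.+1) =>
    exists2 t : n.+1.-tuple R,
      ordered_eigenvalues (signed_laplacian R tau) t &
      exists2 k : nat, (1 <= k <= n.+1)%N &
        \sum_(1 <= j < k.+1) t`_(j.-1) > 'C(n.+1, 2)%:R + 'C(k.+1, 2)%:R).
Proof.
move=> K2 d0 d2 certK s2 sK n2; have s0 : 0 < s by lra.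
pose b k : R := s ^+ k.+1 * (d * n.+1%:R).
have b0 k : 0 < b k by rewrite mulr_gt0 ?exprn_gt0 // mulr_gt0 ?ltr0n.
(* [Y < 1] forces all eight normalised traces below 1 in absolute value. *)
pose Y (tau : signing (complete_graph n.+1)) : R :=
  \sum_(k < 8) (\tr (nb_mx (edge_sign R tau) k.+1) / b k) ^+ 2.
have T0 : (0 < #|signing (complete_graph n.+1)|)%N.
  by apply/card_gt0P; exists [ffun=> false].
apply: le_trans (equiprob_markov (Y := Y) T0 _ _); last first.
- move=> tau Y1; apply: (good_signing K2 d2 certK s2 sK) => -[//|k] /= k8.
  rewrite -/(b k) -[b k]mul1r -ler_pdivrMr // -[X in _ / X]gtr0_norm // -normf_div.
  rewrite -(ler_pXn2r (n := 2)) ?nnegrE // expr1n real_normK ?num_real //.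
  apply: ltW; apply: le_lt_trans Y1; rewrite /Y (bigD1 (Ordinal k8)) //= lerDl.
  by apply: sumr_ge0 => i _; rewrite sqr_ge0.
- by move=> tau; apply: sumr_ge0 => i _; rewrite sqr_ge0.
rewrite lerD2l lerN2 ler_pdivrMr ?ltr0n // /Y exchange_big /=.
rewrite /moment_const mulrAC !mulr_suml; apply: ler_sum => k _.
under eq_bigr do rewrite expr_div_n.
rewrite -mulr_suml ler_pdivrMr ?exprn_gt0 //.
apply: le_trans (trace_nb_mx_second_moment _ _ _) _.
rewrite natrM; set C : R := (_ ^ _)%:R; set M : R := #|_|%:R.
set N : R := n.+1%:R.
have N0 : 0 < N by rewrite ltr0n.
(* This is [n + 1 <= 2 * (n - 1)], which requires [n >= 3]. *)
have Ns : N <= 2 * s ^+ 2.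
  rewrite s2 /N -natr1; have : (3 : R) <= n%:R by rewrite (ler_nat R 3). lra.
have Npow : N ^+ k.+1 <= 2 ^+ k.+1 * (s ^+ k.+1) ^+ 2.
  rewrite exprAC -exprMn lerXn2r // nnegrE; first exact: ltW.
  exact: le_trans (ltW N0) Ns.
rewrite natrX -/N /b -/N.
have -> : d ^- 2 * 2 ^+ k.+1 * C * M / N * (s ^+ k.+1 * (d * N)) ^+ 2 =
  M * C * (2 ^+ k.+1 * (s ^+ k.+1) ^+ 2 * N).
  by field; rewrite !gt_eqF.
by rewrite mulrA [N ^+ k.+2]exprSr ler_wpM2l ?mulr_ge0 ?ler0n // ler_pM2r.
Qed.

Local Open Scope classical_set_scope.
Local Open Scope ring_scope.

Theorem theorem6p1 (R : realType) :
  (fun n : nat =>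
     equiprob R (fun tau : signing (complete_graph n) =>
       exists2 s : n.-tuple R,
         ordered_eigenvalues (signed_laplacian R tau) s &
         exists2 k : nat, (1 <= k <= n)%N &
           \sum_(1 <= j < k.+1) s`_(j.-1) > 'C(n, 2)%:R + 'C(k.+1, 2)%:R))
  @ \oo --> (1 : R).
Proof.
have [K K2 certK] := certificate_bounded R.
have [d d0 d2] : exists2 d : R, 0 < d & 2000 * d <= 2 by exists (2000^-1); lra.
(* The shift passes to graphs on [n + 1] vertices. *)
rewrite -cvg_shiftS /=.
apply: (@squeeze_cvgr _ _ _ _ (fun n => 1 - moment_const d * n.+1%:R^-1) (cst 1)).
- near=> n; rewrite equiprob_le1 andbT.
  have n2 : (2 < n)%N by near: n; exact: nbhs_infty_gt.
  have nK : K ^+ 2 + 1 <= n%:R :> R.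
    by near: n; exact: nbhs_infty_ger.
  have n1 : 0 <= n%:R - 1 :> R by rewrite subr_ge0 ler1n (ltn_trans _ n2).
  apply: (equiprob_good_ge (s := Num.sqrt (n%:R - 1)) K2 d0 d2 certK) => //.
    exact: sqr_sqrtr.
  rewrite -[leLHS]ger0_norm; last by lra.
  by rewrite -sqrtr_sqr ler_wsqrtr // lerBrDr.
- rewrite -[X in _ --> X]subr0; apply: cvgB; first exact: cvg_cst.
  rewrite -[X in _ --> X](mulr0 (moment_const d)); apply: cvgM; first exact: cvg_cst.
  exact: cvg_harmonic.
- exact: cvg_cst.
Unshelve. all: by end_near. Qed.
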